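(* Let $\varphi=(1+\sqrt5)/2$. Let $n\ge3$ and let $a>b\ge c\ge r_4\ge\cdots\ge r_n>0$ be a list of disk radii (set $r_1=a$, $r_2=b$, $r_3=c$), and suppose every tail is at most $\varphi$ times its corresponding radius, i.e. $\sum_{j>i}r_j\le\varphi\,r_i$ for every $i$. Then, for every $R>0$, the entire list of disks fits in a disk of radius $R$ if and only if the three disks of radii $a,b,c$ fit in a disk of radius $R$. (Equality between the smaller radii is permitted.)
   Context: A list of disks of given radii ''fits'' in a disk of radius $R$ (in the plane) if closed disks with these radii can be positioned inside it with pairwise disjoint interiors. *)

(* Defs.v *)
(* Stdlib reals with Coquelicot. The plane is Coquelicot's [C] = R * R, whose
   modulus [Cmod] is the Euclidean norm. *)
From Stdlib Require Import Reals List.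
From Coquelicot Require Import Coquelicot.
Open Scope R_scope.

Definition phi : R := (1 + sqrt 5) / 2.

Definition closed_disk (z : C) (r : R) : C -> Prop :=
  fun w => Cmod (w - z)%C <= r.

Definition interiorC (A : C -> Prop) : C -> Prop :=
  fun w => locally w A.

Definition fits (l : list R) (rho : R) : Prop :=
  exists (o : C) (z : nat -> C),
    (forall i : nat, (i < length l)%nat ->
       forall w : C, closed_disk (z i) (nth i l 0) w -> closed_disk o rho w) /\
    (forall i j : nat, (i < length l)%nat -> (j < length l)%nat -> i <> j ->
       forall w : C,
         ~ (interiorC (closed_disk (z i) (nth i l 0)) w /\
            interiorC (closed_disk (z j) (nth j l 0)) w)).

(* Main.v *)
Require Import Defs.
From Stdlib Require Import Reals Lra Lia Psatz.
From Coquelicot Require Import Coquelicot.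
From Stdlib Require Import List Permutation.
Open Scope R_scope.

(** Write c' for the radius ab(a+b)/(a^2+ab+b^2) of the disk that touches the
    disks a and b and the circle of radius a+b around them, when a and b lie on
    a common diameter of it.  There are two such places, the pockets, one on
    either side of the diameter.  Two golden facts drive the proof.  Let f be
    the sum of the radii after c.  The tail conditions at a and b give
    c + f <= 2c' ([golden_tail_le_pockets]), with equality possible only when
    a = phi b; and disks of total radius f can be strung along a diameter of one
    disk of radius f ([packable_split_disk]), so the tail may be treated as one
    disk, or as its first disk d and one disk e for the rest.

    If c <= c', then a + b <= R anyway, and the packing is built in a disk of
    radius a + b.  If f <= c', the disks c and f occupy the two pockets.
    Otherwise d and e both are at most c (for e because 1 + 1/phi = phi), so the
    larger of them occupies the pocket opposite to c, while the smaller one is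
    so small that it lies next to c ([golden_half_tail_small],
    [packable_pocket_pair]).

    If c > c', the best disk around a, b, c touches all three while they touch
    one another; by Descartes' theorem its curvature is
    2 sqrt(uv+vw+wu) - (u+v+w), where u, v, w are the curvatures of a, b, c.
    That R is at least its radius ([fits_three_curvature]) is a duality
    argument: expand |m1 z1 + m2 z2 + m3 z3|^2 >= 0 for the given centres
    z1, z2, z3, taken relative to the centre of the outer disk, with weights that
    are the barycentric coordinates of that centre when R is optimal.  They are
    nonnegative because c > c', and this is what lets the bounds on the distances
    enter.
    In the optimal disk the second pocket between a and b then takes f
    ([packable_soddy]): as c + f <= 2c' and c exceeds c', f falls below c' by
    at least as much, which the shrinking of that pocket does not outrun
    ([second_pocket_curvature]).

    All packings are checked in one picture.  Invert in the point where the disk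
    a touches the outer circle: the outer circle and the boundary of a become
    the edges of a strip, and the other disks, all taken to touch the outer circle,
    become disks resting on one edge; their feet only have to be one strip width
    apart ([strip_packable]). *)

(** * Disks as centres and radii *)

Lemma interior_closed_disk (z w : C) (r : R) :
  Cmod (w - z) < r -> interiorC (closed_disk z r) w.
Proof.
  intros H.
  assert (He : 0 < (r - Cmod (w - z)) / 2) by lra.
  exists (mkposreal _ He); intros y Hy.
  apply C_NormedModule_mixin_compat2 in Hy.
  change (Cmod (y - w) < sqrt 2 * ((r - Cmod (w - z)) / 2)) in Hy.
  unfold closed_disk.
  replace (y - z)%C with ((y - w) + (w - z))%C by ring.
  pose proof (Cmod_triangle (y - w) (w - z)).
  assert (sqrt 2 < 2) by (rewrite <- (sqrt_Rsqr 2) at 2 by lra;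
    apply sqrt_lt_1; unfold Rsqr; lra).
  nra.
Qed.

(** A point on the bounding circle can be moved radially outwards, out of the
    disk, by an arbitrarily small amount. *)
Lemma interior_closed_disk_inv (z w : C) (r : R) :
  0 < r -> interiorC (closed_disk z r) w -> Cmod (w - z) < r.
Proof.
  intros Hr [eps Heps].
  destruct (Rlt_le_dec (Cmod (w - z)) r) as [H | H]; [exact H | exfalso].
  pose proof (cond_pos eps) as He.
  set (d := Cmod (w - z)) in *.
  assert (Ht : 0 < eps / (2 * d)) by (apply Rdiv_lt_0_compat; lra).
  set (y := (w + RtoC (eps / (2 * d)) * (w - z))%C).
  assert (Hy : closed_disk z r y).
  { apply Heps, C_NormedModule_mixin_compat1.
    change (Cmod (y - w) < eps).
    replace (y - w)%C with (RtoC (eps / (2 * d)) * (w - z))%C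
      by (unfold y; ring).
    rewrite Cmod_mult, Cmod_R, Rabs_pos_eq by lra; fold d.
    replace (eps / (2 * d) * d) with (eps / 2) by (field; lra); lra. }
  unfold closed_disk in Hy.
  replace (y - z)%C with (RtoC (1 + eps / (2 * d)) * (w - z))%C in Hy
    by (unfold y; rewrite RtoC_plus; ring).
  rewrite Cmod_mult, Cmod_R, Rabs_pos_eq in Hy by lra; fold d in Hy.
  replace ((1 + eps / (2 * d)) * d) with (d + eps / 2) in Hy by (field; lra).
  lra.
Qed.

Lemma Cmod_minus_sym (z w : C) : Cmod (z - w) = Cmod (w - z).
Proof. rewrite <- Cmod_opp; f_equal; ring. Qed.

(** The extreme case is the point of the small disk farthest from [o]. *)
Lemma closed_disk_incl_dist (z o : C) (r rho : R) :
  0 < r ->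
  (forall w, closed_disk z r w -> closed_disk o rho w) ->
  Cmod (z - o) + r <= rho.
Proof.
  intros Hr H; unfold closed_disk in H.
  destruct (Req_dec (Cmod (z - o)) 0) as [H0 | H0].
  - assert (Hw : Cmod ((z + r) - o) <= rho).
    { apply H; replace (z + r - z)%C with (RtoC r) by ring.
      rewrite Cmod_R, Rabs_pos_eq; lra. }
    replace (z + r - o)%C with ((z - o) + r)%C in Hw by ring.
    rewrite (Cmod_eq_0 _ H0), Cplus_0_l, Cmod_R, Rabs_pos_eq in Hw by lra; lra.
  - pose proof (Cmod_ge_0 (z - o)) as Hd.
    set (d := Cmod (z - o)) in *.
    assert (Ht : 0 < r / d) by (apply Rdiv_lt_0_compat; lra).
    assert (Hw : Cmod ((z + RtoC (r / d) * (z - o)) - o) <= rho).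
    { apply H.
      replace (z + RtoC (r / d) * (z - o) - z)%C
        with (RtoC (r / d) * (z - o))%C by ring.
      rewrite Cmod_mult, Cmod_R, Rabs_pos_eq by lra; fold d.
      right; field; lra. }
    replace (z + RtoC (r / d) * (z - o) - o)%C
      with (RtoC (1 + r / d) * (z - o))%C in Hw by (rewrite RtoC_plus; ring).
    rewrite Cmod_mult, Cmod_R, Rabs_pos_eq in Hw by lra; fold d in Hw.
    replace ((1 + r / d) * d) with (d + r) in Hw by (field; lra); lra.
Qed.

Lemma disjoint_interiors_dist (z z' : C) (r r' : R) :
  0 < r -> 0 < r' ->
  (forall w, ~ (interiorC (closed_disk z r) w /\
                interiorC (closed_disk z' r') w)) ->
  r + r' <= Cmod (z - z').
Proof.
  intros Hr Hr' H.
  destruct (Rle_lt_dec (r + r') (Cmod (z - z'))) as [Hd | Hd];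
    [exact Hd | exfalso].
  assert (Ht : 0 < / (r + r')) by (apply Rinv_0_lt_compat; lra).
  assert (Hlt : / (r + r') * Cmod (z - z') < 1).
  { apply (Rmult_lt_reg_l (r + r')); [lra |].
    rewrite <- Rmult_assoc, Rinv_r; lra. }
  assert (Hk : r / (r + r') + r' / (r + r') = 1) by (field; lra).
  (* The point dividing the segment of centres in the ratio of the radii. *)
  apply (H (RtoC (r' / (r + r')) * z + RtoC (r / (r + r')) * z')%C);
    split; apply interior_closed_disk.
  - replace (RtoC (r' / (r + r')) * z + RtoC (r / (r + r')) * z' - z)%C
      with (RtoC (r / (r + r')) * (z' - z))%C.
    2:{ replace (r' / (r + r')) with (1 - r / (r + r')) by lra.
        rewrite RtoC_minus; ring. }
    rewrite Cmod_mult, Cmod_R, Rabs_pos_eq, (Cmod_minus_sym z').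
    + unfold Rdiv; nra.
    + unfold Rdiv; nra.
  - replace (RtoC (r' / (r + r')) * z + RtoC (r / (r + r')) * z' - z')%C
      with (RtoC (r' / (r + r')) * (z - z'))%C.
    2:{ replace (r / (r + r')) with (1 - r' / (r + r')) by lra.
        rewrite RtoC_minus; ring. }
    rewrite Cmod_mult, Cmod_R, Rabs_pos_eq.
    + unfold Rdiv; nra.
    + unfold Rdiv; nra.
Qed.

Lemma fits_separated (l : list R) (rho : R) :
  fits l rho -> Forall (fun x => 0 < x) l ->
  exists z : nat -> C,
    (forall i, (i < length l)%nat -> Cmod (z i) + nth i l 0 <= rho) /\
    (forall i j, (i < length l)%nat -> (j < length l)%nat -> i <> j ->
       nth i l 0 + nth j l 0 <= Cmod (z i - z j)).
Proof.
  intros (o & z & Hin & Hdis) Hpos.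
  assert (Hp : forall i, (i < length l)%nat -> 0 < nth i l 0).
  { intros i Hi; rewrite Forall_forall in Hpos; apply Hpos, nth_In, Hi. }
  exists (fun i => (z i - o)%C); split.
  - intros i Hi; apply closed_disk_incl_dist; [exact (Hp i Hi) | exact (Hin i Hi)].
  - intros i j Hi Hj Hij.
    replace (z i - o - (z j - o))%C with (z i - z j)%C by ring.
    exact (disjoint_interiors_dist _ _ _ _ (Hp i Hi) (Hp j Hj) (Hdis i j Hi Hj Hij)).
Qed.

Lemma fits_app_l (l l' : list R) (rho : R) : fits (l ++ l') rho -> fits l rho.
Proof.
  intros (o & z & Hin & Hdis); rewrite length_app in *.
  exists o, z; split.
  - intros i Hi; rewrite <- (app_nth1 l l') by exact Hi; apply Hin; lia.
  - intros i j Hi Hj.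
    rewrite <- (app_nth1 l l' 0 Hi), <- (app_nth1 l l' 0 Hj).
    apply Hdis; lia.
Qed.

Definition apart (d e : C * R) : Prop :=
  snd d + snd e <= Cmod (fst d - fst e).

Lemma apart_sym (d e : C * R) : apart d e -> apart e d.
Proof. unfold apart; rewrite Cmod_minus_sym; lra. Qed.

Definition inside (o : C) (rho : R) (d : C * R) : Prop :=
  Cmod (fst d - o) + snd d <= rho.

(** Listing the disks, rather than indexing them, makes it possible to permute
    them and to replace one of them by several. *)
Definition packable (rho : R) (l : list R) : Prop :=
  exists P : list (C * R),
    map snd P = l /\ Forall (fun d => 0 < snd d) P /\
    Forall (inside 0 rho) P /\ ForallOrdPairs apart P.

Lemma ForallOrdPairs_Permutation {A : Type} (Q : A -> A -> Prop) (l l' : list A) :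
  (forall x y, Q x y -> Q y x) ->
  Permutation l l' -> ForallOrdPairs Q l -> ForallOrdPairs Q l'.
Proof.
  intros Hsym Hperm; induction Hperm as [| x l l' Hp IH | x y l | l l' l'' _ IH _ IH'];
    intros H; auto.
  - inversion_clear H; constructor; auto.
    now apply (Permutation_Forall Hp).
  - inversion_clear H as [| ? ? Hx Hl]; inversion_clear Hl;
      inversion_clear Hx; repeat constructor; auto.
Qed.

Lemma packable_Permutation (rho : R) (l l' : list R) :
  Permutation l l' -> packable rho l -> packable rho l'.
Proof.
  intros Hperm (P & <- & Hpos & Hin & Hap).
  destruct (Permutation_map_inv _ _ (Permutation_sym Hperm)) as (P' & -> & HP).
  exists P'; split; [reflexivity |].
  split; [exact (Permutation_Forall HP Hpos) |].
  split; [exact (Permutation_Forall HP Hin) |].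
  exact (ForallOrdPairs_Permutation _ _ _ apart_sym HP Hap).
Qed.

Lemma packable_le (rho rho' : R) (l : list R) :
  rho <= rho' -> packable rho l -> packable rho' l.
Proof.
  intros Hle (P & Hl & Hpos & Hin & Hap).
  exists P; split; [exact Hl | split; [exact Hpos | split; [| exact Hap]]].
  revert Hin; apply Forall_impl; unfold inside; intros; lra.
Qed.

Lemma ForallOrdPairs_nth {A : Type} (Q : A -> A -> Prop) (x0 : A) (l : list A) :
  (forall x y, Q x y -> Q y x) -> ForallOrdPairs Q l ->
  forall i j, (i < length l)%nat -> (j < length l)%nat -> i <> j ->
    Q (nth i l x0) (nth j l x0).
Proof.
  intros Hsym H; induction H as [| x l Hx Hl IH]; simpl; intros i j Hi Hj Hij.
  - lia.
  - rewrite Forall_forall in Hx.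
    destruct i as [| i], j as [| j]; try lia.
    + apply Hx, nth_In; lia.
    + apply Hsym, Hx, nth_In; lia.
    + apply IH; lia.
Qed.

Lemma packable_fits (rho : R) (l : list R) : packable rho l -> fits l rho.
Proof.
  intros (P & <- & Hpos & Hin & Hap).
  exists 0%C, (fun i => fst (nth i P (RtoC 0, 0))); rewrite length_map.
  assert (Hsnd : forall i, nth i (map snd P) 0 = snd (nth i P (RtoC 0, 0)))
    by (intros i; apply (map_nth snd P (RtoC 0, 0))).
  rewrite Forall_forall in Hpos, Hin.
  split.
  - intros i Hi w; rewrite Hsnd; unfold closed_disk; intros Hw.
    pose proof (Hin _ (nth_In P (RtoC 0, 0) Hi)) as H; unfold inside in H.
    set (d := nth i P (RtoC 0, 0)) in *.
    replace (w - 0)%C with ((w - fst d) + (fst d - 0))%C by ring.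
    pose proof (Cmod_triangle (w - fst d) (fst d - 0)); lra.
  - intros i j Hi Hj Hij w; rewrite !Hsnd; intros [H1 H2].
    pose proof (ForallOrdPairs_nth _ (RtoC 0, 0) _ apart_sym Hap i j Hi Hj Hij) as H.
    apply interior_closed_disk_inv in H1; [| apply Hpos, nth_In, Hi].
    apply interior_closed_disk_inv in H2; [| apply Hpos, nth_In, Hj].
    unfold apart in H.
    set (d := nth i P (RtoC 0, 0)) in *; set (e := nth j P (RtoC 0, 0)) in *.
    replace (fst d - fst e)%C with ((w - fst e) + (fst d - w))%C in H by ring.
    pose proof (Cmod_triangle (w - fst e) (fst d - w)) as Ht.
    rewrite (Cmod_minus_sym (fst d)) in Ht; lra.
Qed.

Definition lsum (l : list R) : R := fold_right Rplus 0 l.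

(** Strung along a diameter, disks need no more room than one disk whose radius
    is the sum of theirs. *)
Lemma disks_on_diameter (l : list R) (F : R) (o : C) :
  Forall (fun x => 0 < x) l -> lsum l <= F ->
  exists P : list (C * R),
    map snd P = l /\ Forall (inside o F) P /\ ForallOrdPairs apart P.
Proof.
  intros Hl; revert F o; induction Hl as [| r l Hr Hl IH]; intros F o HF.
  - exists nil; repeat constructor.
  - change (r + lsum l <= F) in HF.
    destruct (IH (F - r) (o + r)%C) as (P & Hm & Hin & Hap); [lra |].
    assert (Hs : 0 <= lsum l).
    { clear - Hl; induction Hl; simpl; lra. }
    exists (((o - RtoC (F - r))%C, r) :: P); simpl; rewrite Hm.
    split; [reflexivity | split; constructor; try exact Hap].
    + unfold inside; simpl.
      replace (o - (F - r)%R - o)%C with (- RtoC (F - r))%C by ring.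
      rewrite Cmod_opp, Cmod_R, Rabs_pos_eq; lra.
    + revert Hin; apply Forall_impl; unfold inside; intros d Hd.
      replace (fst d - o)%C with ((fst d - (o + r)) + r)%C by ring.
      pose proof (Cmod_triangle (fst d - (o + r)) r) as Ht.
      rewrite (Cmod_R r), Rabs_pos_eq in Ht; lra.
    + revert Hin; apply Forall_impl; unfold inside, apart; simpl; intros d Hd.
      pose proof (Cmod_triangle (o - RtoC (F - r) - fst d) (fst d - (o + r))) as Ht.
      replace (o - RtoC (F - r) - fst d + (fst d - (o + r)))%C
        with (- RtoC F)%C in Ht by (rewrite RtoC_minus; ring).
      rewrite Cmod_opp, Cmod_R, Rabs_pos_eq in Ht; lra.
Qed.

(** A disk inside a disk of the packing inherits its distances to the others, by
    the triangle inequality. *)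
Lemma packable_split_head (rho F : R) (l m : list R) :
  Forall (fun x => 0 < x) l -> lsum l <= F ->
  packable rho (F :: m) -> packable rho (l ++ m).
Proof.
  intros Hl HF (P & Hm & Hpos & Hin & Hap).
  destruct P as [| [z F'] P]; simpl in Hm; [discriminate |].
  injection Hm as -> <-.
  inversion_clear Hin as [| ? ? Hz Hin']; inversion_clear Hap as [| ? ? Hzap Hap'].
  inversion_clear Hpos as [| ? ? _ Hpos'].
  destruct (disks_on_diameter l F z Hl HF) as (Q & <- & HQin & HQap).
  exists (Q ++ P); rewrite map_app; split; [reflexivity |].
  rewrite !Forall_app; split; [split; [| exact Hpos'] | split; [split; [| exact Hin'] |]].
  - rewrite Forall_forall in *; intros d Hd; apply Hl, in_map, Hd.
  - revert HQin; apply Forall_impl; unfold inside in *; cbn [fst snd] in Hz; intros d Hd.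
    replace (fst d - 0)%C with ((fst d - z) + (z - 0))%C by ring.
    pose proof (Cmod_triangle (fst d - z) (z - 0)); lra.
  - clear - HQin HQap Hzap Hap'.
    induction HQap as [| d Q Hd HQ IH]; simpl; [exact Hap' |].
    inversion_clear HQin as [| ? ? Hdin HQin'].
    constructor; [| exact (IH HQin')].
    apply Forall_app; split; [exact Hd |].
    revert Hzap; apply Forall_impl; unfold inside, apart in *; cbn [fst snd].
    intros e He.
    pose proof (Cmod_triangle (z - fst d) (fst d - fst e)) as Ht.
    replace (z - fst d + (fst d - fst e))%C with (z - fst e)%C in Ht by ring.
    rewrite (Cmod_minus_sym z (fst d)) in Ht; lra.
Qed.

Lemma packable_split_disk (rho F : R) (l m m' : list R) :
  Forall (fun x => 0 < x) l -> lsum l <= F ->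
  packable rho (m ++ F :: m') -> packable rho (m ++ m' ++ l).
Proof.
  intros Hl HF H; rewrite app_assoc.
  apply packable_Permutation with (l ++ (m ++ m')); [apply Permutation_app_comm |].
  apply (packable_split_head rho F); [exact Hl | exact HF |].
  revert H; apply packable_Permutation, Permutation_sym, Permutation_middle.
Qed.

(** * Disks tangent to the outer circle *)

Lemma Cmod_sq (z : C) : Cmod z ^ 2 = fst z ^ 2 + snd z ^ 2.
Proof. apply Cmod2_alt. Qed.

(** For two disks of radii r and r' that touch the outer circle from inside and
    each other, their directions from its centre form an angle t with
    sin(t/2)^2 = 1 / (excess r * excess r'); Descartes' theorem and the choice of
    positions become polynomial in these quantities. *)
Definition excess (rho r : R) : R := rho / r - 1.

(** A disk is given by a pair (p, r), where p is the cotangent of half the polar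
    angle at which it touches the outer circle.  Then p is also the coordinate
    along the strip after inversion in the point of polar angle 0, and the image
    of the disk has height (1 + p^2) / excess r above the image of the outer
    circle. *)
Definition rim_centre (rho : R) (d : R * R) : C :=
  ((rho - snd d) * ((fst d ^ 2 - 1) / (fst d ^ 2 + 1)),
   (rho - snd d) * (2 * fst d / (fst d ^ 2 + 1))).

Lemma rim_centre_mod (rho p r : R) :
  r < rho -> Cmod (rim_centre rho (p, r)) = rho - r.
Proof.
  intros Hr; apply Rsqr_inj; [apply Cmod_ge_0 | lra |].
  rewrite !Rsqr_pow2, Cmod_sq; unfold rim_centre; simpl fst; simpl snd.
  field; nra.
Qed.

Lemma le_Cmod (s : R) (z : C) : s ^ 2 <= Cmod z ^ 2 -> s <= Cmod z.
Proof.
  intros H; pose proof (Cmod_ge_0 z).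
  destruct (Rle_lt_dec s (Cmod z)) as [|Hs]; [assumption | nra].
Qed.

(** Disks of heights h and h' resting on a line are disjoint exactly when their
    feet are at distance at least sqrt(h h'). *)
Lemma rim_apart (rho p r p' r' : R) :
  0 < r < rho -> 0 < r' < rho ->
  (1 + p ^ 2) * (1 + p' ^ 2) <=
    excess rho r * excess rho r' * (p - p') ^ 2 ->
  apart (rim_centre rho (p, r), r) (rim_centre rho (p', r'), r').
Proof.
  intros Hr Hr' H; unfold apart; apply le_Cmod.
  rewrite Cmod_sq; unfold rim_centre; simpl fst; simpl snd.
  assert (Hp : 0 < 1 + p ^ 2) by nra; assert (Hp' : 0 < 1 + p' ^ 2) by nra.
  match goal with |- _ <= ?X =>
    replace X with ((r - r') ^ 2 + 4 * ((rho - r) * (rho - r')) *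
      ((p - p') ^ 2 / ((1 + p ^ 2) * (1 + p' ^ 2)))) end.
  2:{ simpl; field; nra. }
  assert (Hs : r * r' <= (rho - r) * (rho - r') *
                 ((p - p') ^ 2 / ((1 + p ^ 2) * (1 + p' ^ 2)))).
  { apply (Rmult_le_reg_r ((1 + p ^ 2) * (1 + p' ^ 2))); [nra |].
    replace ((rho - r) * (rho - r') * ((p - p') ^ 2 / ((1 + p ^ 2) * (1 + p' ^ 2)))
             * ((1 + p ^ 2) * (1 + p' ^ 2)))
      with (r * r' * (excess rho r * excess rho r' * (p - p') ^ 2)).
    - apply Rmult_le_compat_l; [nra | exact H].
    - unfold excess; field; nra. }
  lra.
Qed.

(** The disk at p = infinity: its image is the half-plane above height
    [excess rho a]. *)
Lemma rim_apart_base (rho a p r : R) :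
  0 < a < rho -> 0 < r < rho ->
  1 + p ^ 2 <= excess rho a * excess rho r ->
  apart (RtoC (rho - a), a) (rim_centre rho (p, r), r).
Proof.
  intros Ha Hr H; unfold apart; apply le_Cmod.
  rewrite Cmod_sq; unfold rim_centre; simpl fst; simpl snd.
  assert (Hp : 0 < 1 + p ^ 2) by nra.
  match goal with |- _ <= ?X =>
    replace X with ((a - r) ^ 2 + 4 * ((rho - a) * (rho - r) / (1 + p ^ 2))) end.
  2:{ simpl; field; nra. }
  assert (Hs : a * r <= (rho - a) * (rho - r) / (1 + p ^ 2)).
  { apply (Rmult_le_reg_r (1 + p ^ 2)); [exact Hp |].
    replace ((rho - a) * (rho - r) / (1 + p ^ 2) * (1 + p ^ 2))
      with (a * r * (excess rho a * excess rho r)).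
    - apply Rmult_le_compat_l; [nra | exact H].
    - unfold excess; field; nra. }
  lra.
Qed.

Lemma excess_pos (rho r : R) : 0 < r < rho -> 0 < excess rho r.
Proof.
  intros Hr; unfold excess.
  replace (rho / r - 1) with ((rho - r) / r) by (field; lra).
  apply Rdiv_lt_0_compat; lra.
Qed.

(** Since all images have height at most the width of the strip, feet one width
    apart suffice. *)
Lemma strip_packable (rho a : R) (L : list (R * R)) :
  0 < a < rho ->
  Forall (fun d => 0 < snd d < rho /\
                   1 + fst d ^ 2 <= excess rho a * excess rho (snd d)) L ->
  ForallOrdPairs (fun d e => excess rho a <= Rabs (fst d - fst e)) L ->
  packable rho (a :: map snd L).
Proof.
  intros Ha HL Hsep.
  exists ((RtoC (rho - a), a) :: map (fun d => (rim_centre rho d, snd d)) L).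
  split; [simpl; rewrite map_map; reflexivity |].
  split; [| split]; constructor; simpl.
  - lra.
  - apply Forall_map; revert HL; apply Forall_impl; simpl; intros; lra.
  - unfold inside; simpl.
    replace (RtoC (rho - a) - 0)%C with (RtoC (rho - a)) by ring.
    rewrite Cmod_R, Rabs_pos_eq; lra.
  - apply Forall_map; revert HL; apply Forall_impl.
    intros [p r] [Hr _]; unfold inside; simpl fst; simpl snd in *.
    replace (rim_centre rho (p, r) - 0)%C with (rim_centre rho (p, r)) by ring.
    rewrite rim_centre_mod; lra.
  - apply Forall_map; revert HL; apply Forall_impl.
    intros [p r] [Hr H]; apply rim_apart_base; assumption.
  - pose proof (excess_pos _ _ Ha) as Hk.
    induction Hsep as [| [p r] L Hd Hsep IH]; simpl; constructor.
    + inversion_clear HL as [| ? ? [Hr Hp] HL'].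
      apply Forall_map; rewrite Forall_forall in *; intros [p' r'] Hin.
      specialize (Hd _ Hin); destruct (HL' _ Hin) as [Hr' Hp'].
      simpl in Hr, Hp, Hr', Hp', Hd; apply rim_apart; try assumption.
      pose proof (excess_pos _ _ Hr); pose proof (excess_pos _ _ Hr').
      assert (Hsq : excess rho a ^ 2 <= (p - p') ^ 2).
      { rewrite <- (pow2_abs (p - p')); apply pow_incr; lra. }
      apply Rle_trans with ((excess rho a * excess rho r) * (excess rho a * excess rho r')).
      * apply Rmult_le_compat; simpl; nra.
      * assert (0 < excess rho r * excess rho r') by nra.
        cbn [fst snd].
        replace (excess rho a * excess rho r * (excess rho a * excess rho r'))
          with (excess rho r * excess rho r' * excess rho a ^ 2) by ring.
        apply Rmult_le_compat_l; lra.
    + inversion_clear HL; apply IH; assumption.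
Qed.

(** * A pair of disks and their two pockets *)

Ltac split_list :=
  repeat (apply Forall_nil || apply FOP_nil || apply Forall_cons || apply FOP_cons);
  cbn [fst snd].

(** If the disks a and b touch, the image of b spans the strip with its foot at
    q, and the images of c and f stand next to it on either side.  By Descartes'
    theorem the bounds on the excesses of c and f say that they are no larger than
    the disks touching a, b and the outer circle. *)
Lemma packable_pockets (rho a b c f q : R) :
  0 < a < rho -> 0 < b < rho -> 0 < c < rho -> 0 < f < rho ->
  excess rho a * excess rho b = 1 + q ^ 2 ->
  excess rho a + excess rho b - 2 * q <= excess rho c ->
  excess rho a + excess rho b + 2 * q <= excess rho f ->
  packable rho (a :: b :: c :: f :: nil).
Proof.
  intros Ha Hb Hc Hf Hab Hxc Hxf.
  pose proof (excess_pos _ _ Ha) as Hk; set (k := excess rho a) in *.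
  apply (strip_packable rho a ((q, b) :: (q - k, c) :: (q + k, f) :: nil)); [exact Ha | |];
    fold k.
  - split_list; try lra; nra.
  - split_list.
    + replace (q - (q - k)) with k by ring; rewrite Rabs_pos_eq; lra.
    + replace (q - (q + k)) with (- k) by ring; rewrite Rabs_Ropp, Rabs_pos_eq; lra.
    + replace (q - k - (q + k)) with (- (2 * k)) by ring; rewrite Rabs_Ropp, Rabs_pos_eq; lra.
Qed.

(** Radius of the disk touching a, b and the circle of radius a + b around both,
    by Descartes' theorem with curvatures 1/a, 1/b and -1/(a + b). *)
Definition pocket (a b : R) : R := a * b * (a + b) / (a ^ 2 + a * b + b ^ 2).

Lemma pocket_pos (a b : R) : 0 < a -> 0 < b -> 0 < pocket a b.
Proof.
  intros Ha Hb; unfold pocket; apply Rdiv_lt_0_compat; [| nra].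
  repeat apply Rmult_lt_0_compat; lra.
Qed.

Lemma pocket_inv (a b : R) :
  0 < a -> 0 < b -> / pocket a b = / a + / b - / (a + b).
Proof. intros Ha Hb; unfold pocket; field; repeat split; nra. Qed.

Lemma pocket_excess (a b c : R) :
  0 < a -> 0 < b -> 0 < c -> c <= pocket a b ->
  a / b + b / a <= excess (a + b) c.
Proof.
  intros Ha Hb Hc H; unfold excess.
  assert (HQ : 0 < a ^ 2 + a * b + b ^ 2) by nra.
  apply (Rmult_le_reg_r c); [exact Hc |].
  replace (((a + b) / c - 1) * c) with (a + b - c) by (field; lra).
  replace (a + b) with (pocket a b * (1 + a / b + b / a)) by (unfold pocket; field; nra).
  assert (0 < a / b) by (apply Rdiv_lt_0_compat; lra).
  assert (0 < b / a) by (apply Rdiv_lt_0_compat; lra).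
  nra.
Qed.

Lemma pocket_lt (a b : R) : 0 < a -> 0 < b -> pocket a b < a + b.
Proof.
  intros Ha Hb; unfold pocket; assert (HQ : 0 < a ^ 2 + a * b + b ^ 2) by nra.
  apply (Rmult_lt_reg_r (a ^ 2 + a * b + b ^ 2)); [exact HQ |].
  unfold Rdiv; rewrite Rmult_assoc, Rinv_l by lra; nra.
Qed.

Lemma packable_two_pockets (a b c f : R) :
  0 < a -> 0 < b -> 0 < c <= pocket a b -> 0 < f <= pocket a b ->
  packable (a + b) (a :: b :: c :: f :: nil).
Proof.
  intros Ha Hb [Hc Hcp] [Hf Hfp]; pose proof (pocket_lt a b Ha Hb).
  pose proof (pocket_excess a b c Ha Hb Hc Hcp).
  pose proof (pocket_excess a b f Ha Hb Hf Hfp).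
  apply packable_pockets with (q := 0); try lra.
  - unfold excess; field; lra.
  - unfold excess in *.
    replace ((a + b) / a - 1) with (b / a) by (field; lra).
    replace ((a + b) / b - 1) with (a / b) by (field; lra); lra.
  - unfold excess in *.
    replace ((a + b) / a - 1) with (b / a) by (field; lra).
    replace ((a + b) / b - 1) with (a / b) by (field; lra); lra.
Qed.

(** With rho = a + b the image of b has its foot at 0 and the strip has width
    k = b/a.  Pocket-sized disks go at k and -k; a disk small enough for the strip
    at 2k shares the pocket of c. *)
Lemma packable_pocket_pair (a b c d e : R) :
  0 < a -> 0 < b -> 0 < c <= pocket a b -> 0 < d <= pocket a b -> 0 < e ->
  e * (1 + a / b + 4 * (b / a)) <= a + b ->
  packable (a + b) (a :: b :: c :: d :: e :: nil).
Proof.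
  intros Ha Hb [Hc Hcp] [Hd Hdp] He Hep; pose proof (pocket_lt a b Ha Hb).
  pose proof (pocket_excess a b c Ha Hb Hc Hcp) as Hxc.
  pose proof (pocket_excess a b d Ha Hb Hd Hdp) as Hxd.
  assert (Hk : 0 < b / a) by (apply Rdiv_lt_0_compat; lra).
  assert (Hk' : 0 < a / b) by (apply Rdiv_lt_0_compat; lra).
  assert (Hkk : b / a * (a / b) = 1) by (field; lra).
  assert (Hxe : a / b + 4 * (b / a) <= excess (a + b) e).
  { unfold excess; apply (Rmult_le_reg_r e); [exact He |].
    replace (((a + b) / e - 1) * e) with (a + b - e) by (field; lra); lra. }
  assert (Hea : e < a + b) by nra.
  assert (Hxa : excess (a + b) a = b / a) by (unfold excess; field; lra).
  assert (Hxb : excess (a + b) b = a / b) by (unfold excess; field; lra).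
  set (k := b / a) in *; set (k' := a / b) in *.
  apply (strip_packable (a + b) a
    ((0, b) :: (k, c) :: (- k, d) :: (2 * k, e) :: nil)); [lra | |]; rewrite Hxa.
  - split_list; rewrite ?Hxb; try lra; nra.
  - split_list;
      match goal with |- _ <= Rabs ?x =>
        destruct (Rle_lt_dec 0 x);
          [rewrite Rabs_pos_eq by assumption | rewrite Rabs_left by assumption] end;
      lra.
Qed.

(** * Three disks in a disk *)

(** The difference of the two sides is |m1 z1 + m2 z2 + m3 z3|^2. *)
Lemma barycentric_dist_le (z1 z2 z3 : C) (m1 m2 m3 : R) :
  m1 * m2 * Cmod (z1 - z2) ^ 2 + m2 * m3 * Cmod (z2 - z3) ^ 2
    + m3 * m1 * Cmod (z3 - z1) ^ 2
  <= (m1 + m2 + m3) * (m1 * Cmod z1 ^ 2 + m2 * Cmod z2 ^ 2 + m3 * Cmod z3 ^ 2).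
Proof.
  rewrite !Cmod_sq; destruct z1 as [x1 y1], z2 as [x2 y2], z3 as [x3 y3].
  unfold Cminus, Cplus, Copp; cbn [fst snd].
  pose proof (pow2_ge_0 (m1 * x1 + m2 * x2 + m3 * x3)).
  pose proof (pow2_ge_0 (m1 * y1 + m2 * y2 + m3 * y3)).
  nra.
Qed.

Lemma fits_two_le (a b c rho : R) :
  0 < a -> 0 < b -> 0 < c -> fits (a :: b :: c :: nil) rho -> a + b <= rho.
Proof.
  intros Ha Hb Hc Hf.
  destruct (fits_separated _ _ Hf) as (z & Hin & Hap); [repeat (constructor; try assumption) |].
  cbn [length] in *.
  pose proof (Hin 0%nat ltac:(lia)) as H0; pose proof (Hin 1%nat ltac:(lia)) as H1.
  pose proof (Hap 0%nat 1%nat ltac:(lia) ltac:(lia) ltac:(lia)) as H01.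
  cbn [nth] in *.
  pose proof (Cmod_triangle (z 0%nat) (- z 1%nat)) as Ht; rewrite Cmod_opp in Ht.
  change (z 0%nat + - z 1%nat)%C with (z 0%nat - z 1%nat)%C in Ht; lra.
Qed.

Lemma fits_three_weights (a b c rho m1 m2 m3 : R) :
  0 < a -> 0 < b -> 0 < c -> 0 <= m1 -> 0 <= m2 -> 0 <= m3 ->
  fits (a :: b :: c :: nil) rho ->
  m1 * m2 * (a + b) ^ 2 + m2 * m3 * (b + c) ^ 2 + m3 * m1 * (c + a) ^ 2
  <= (m1 + m2 + m3) *
     (m1 * (rho - a) ^ 2 + m2 * (rho - b) ^ 2 + m3 * (rho - c) ^ 2).
Proof.
  intros Ha Hb Hc Hm1 Hm2 Hm3 Hf.
  destruct (fits_separated _ _ Hf) as (z & Hin & Hap); [repeat (constructor; try assumption) |].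
  cbn [length] in *.
  assert (Hi : forall i r, (i < 3)%nat -> nth i (a :: b :: c :: nil) 0 = r ->
                 Cmod (z i) ^ 2 <= (rho - r) ^ 2).
  { intros i r Hi <-; specialize (Hin i Hi); pose proof (Cmod_ge_0 (z i)).
    apply pow_incr; lra. }
  assert (Hd : forall i j r s, (i < 3)%nat -> (j < 3)%nat -> i <> j -> 0 < r -> 0 < s ->
                 nth i (a :: b :: c :: nil) 0 = r ->
                 nth j (a :: b :: c :: nil) 0 = s ->
                 (r + s) ^ 2 <= Cmod (z i - z j) ^ 2).
  { intros i j r s Hi' Hj' Hij Hr Hs <- <-; specialize (Hap i j Hi' Hj' Hij).
    apply pow_incr; lra. }
  pose proof (Hi 0%nat a ltac:(lia) eq_refl) as I0.
  pose proof (Hi 1%nat b ltac:(lia) eq_refl) as I1.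
  pose proof (Hi 2%nat c ltac:(lia) eq_refl) as I2.
  pose proof (Hd 0%nat 1%nat a b ltac:(lia) ltac:(lia) ltac:(lia) Ha Hb eq_refl eq_refl) as D0.
  pose proof (Hd 1%nat 2%nat b c ltac:(lia) ltac:(lia) ltac:(lia) Hb Hc eq_refl eq_refl) as D1.
  pose proof (Hd 2%nat 0%nat c a ltac:(lia) ltac:(lia) ltac:(lia) Hc Ha eq_refl eq_refl) as D2.
  eapply Rle_trans; [| eapply Rle_trans;
    [apply (barycentric_dist_le (z 0%nat) (z 1%nat) (z 2%nat) m1 m2 m3) |]].
  - repeat apply Rplus_le_compat; (apply Rmult_le_compat_l; [nra | assumption]).
  - apply Rmult_le_compat_l; [lra |].
    repeat apply Rplus_le_compat; (apply Rmult_le_compat_l; assumption).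
Qed.

(** Curvature of the outer Soddy circle of three mutually tangent disks. *)
Definition enclosing_curv (a b c : R) : R :=
  2 * sqrt (/ a * / b + / c * (/ a + / b)) - (/ a + / b + / c).

(** The hypothesis on c says that the centre of the enclosing disk lies strictly
    inside the triangle of centres in the tangent configuration, and it makes the
    weights below positive.  If x, y, z are the excesses and
    S = 4xy - (x+y-z)^2, then [fits_three_weights] reads S^2 >= 4S, hence S >= 4,
    and S = 4 is Descartes' equation for rho. *)
Lemma fits_three_curvature (a b c rho : R) :
  0 < c <= b -> b <= a -> pocket a b < c ->
  fits (a :: b :: c :: nil) rho ->
  0 < rho /\ 1 <= rho * enclosing_curv a b c.
Proof.
  intros Hcb Hba Hp Hf.
  assert (Hrho : a + b <= rho) by (apply (fits_two_le a b c); lra || assumption).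
  split; [lra |].
  assert (Hva : 0 < / a) by (apply Rinv_0_lt_compat; lra).
  assert (Hvb : 0 < / b) by (apply Rinv_0_lt_compat; lra).
  assert (Hvc : 0 < / c) by (apply Rinv_0_lt_compat; lra).
  set (x := excess rho a); set (y := excess rho b); set (z := excess rho c).
  assert (Hx : 0 < x) by (apply excess_pos; lra).
  assert (Hxy : x <= y).
  { unfold x, y, excess, Rdiv.
    assert (/ a <= / b) by (apply Rinv_le_contravar; lra). nra. }
  assert (Hyz : y <= z).
  { unfold y, z, excess, Rdiv.
    assert (/ b <= / c) by (apply Rinv_le_contravar; lra). nra. }
  assert (Hz : z < x + y).
  { assert (Hpc : / c < / pocket a b).
    { apply Rinv_lt_contravar; [| exact Hp].
      apply Rmult_lt_0_compat; [apply pocket_pos |]; lra. }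
    rewrite pocket_inv in Hpc by lra.
    assert (1 <= rho * / (a + b)).
    { apply (Rmult_le_reg_r (a + b)); [lra |].
      rewrite Rmult_assoc, Rinv_l; lra. }
    unfold x, y, z, excess, Rdiv; nra. }
  (* Up to a common factor, these weights are the barycentric coordinates of the
     outer centre when the three disks touch one another and the outer circle. *)
  pose proof (fits_three_weights a b c rho ((y + z - x) * / a) ((z + x - y) * / b)
    ((x + y - z) * / c) ltac:(lra) ltac:(lra) ltac:(lra)
    ltac:(apply Rmult_le_pos; lra) ltac:(apply Rmult_le_pos; lra)
    ltac:(apply Rmult_le_pos; lra) Hf) as H.
  assert (HS : 0 < 4 * x * y - (x + y - z) ^ 2) by nra.
  assert (HS4 : 4 <= 4 * x * y - (x + y - z) ^ 2).
  { assert (Hid : 0 <= (4 * x * y - (x + y - z) ^ 2) * (4 * x * y - (x + y - z) ^ 2 - 4)).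
    { apply Rminus_le_0 in H.
      match type of H with 0 <= ?E => replace E with
        ((4 * x * y - (x + y - z) ^ 2) * (4 * x * y - (x + y - z) ^ 2 - 4)) in H end.
      - exact H.
      - unfold x, y, z, excess; field; lra. }
    nra. }
  unfold enclosing_curv.
  set (s := sqrt _).
  assert (Hs0 : 0 <= s) by apply sqrt_pos.
  assert (Hs : s ^ 2 = / a * / b + / c * (/ a + / b)).
  { apply pow2_sqrt; nra. }
  assert (Hsq : (1 + rho * (/ a + / b + / c)) ^ 2 <= (2 * rho * s) ^ 2).
  { replace ((2 * rho * s) ^ 2) with (4 * rho ^ 2 * (/ a * / b + / c * (/ a + / b)))
      by (rewrite <- Hs; ring).
    unfold x, y, z, excess, Rdiv in HS4; nra. }
  assert (0 <= 2 * rho * s) by nra.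
  assert (1 + rho * (/ a + / b + / c) <= 2 * rho * s) by nra.
  lra.
Qed.

(** Here u, v, w are the curvatures of a, b, c, and the left-hand side is the
    curvature of the other disk that touches a, b and the circle around all
    three: the two roots of Descartes' equation add up to 2(u + v - T), with T the
    curvature of that circle.  Let K be the curvature of the pocket and d = K - w.
    The two sides of the conclusion agree to first order in d in the extremal case
    /w + f = 2/K, so the proof keeps the second-order term: it interposes
    K + d + 2 d^2 / K between them. *)
Lemma second_pocket_curvature (u v w f : R) :
  0 < u -> 0 < v -> 0 < w <= (u ^ 2 + u * v + v ^ 2) / (u + v) -> 0 < f ->
  / w + f <= 2 * ((u + v) / (u ^ 2 + u * v + v ^ 2)) ->
  4 * (u + v) + w - 4 * sqrt (u * v + w * (u + v)) <= / f.
Proof.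
  intros Hu Hv [Hw HwK] Hf Hcf.
  set (A := u + v) in *.
  assert (HA : 0 < A) by (unfold A; lra).
  assert (HQ : 0 < u ^ 2 + u * v + v ^ 2) by nra.
  set (K := (u ^ 2 + u * v + v ^ 2) / A) in *.
  assert (HKA : K * A = u ^ 2 + u * v + v ^ 2) by (unfold K; field; lra).
  assert (HK : 0 < K) by (unfold K; apply Rdiv_lt_0_compat; lra).
  assert (HKle : K <= A).
  { apply (Rmult_le_reg_r A); [exact HA |]. rewrite HKA; unfold A; nra. }
  replace (A / (u ^ 2 + u * v + v ^ 2)) with (/ K) in Hcf by (unfold K; field; lra).
  set (d := K - w); assert (Hd : 0 <= d < K) by (unfold d; lra).
  replace w with (K - d) in * by (unfold d; ring).
  set (L := 2 * d * (1 + d / K)).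
  assert (Ht : 0 <= d / K <= 1).
  { split; [apply Rdiv_le_0_compat; lra |].
    apply (Rmult_le_reg_r K); [exact HK |]. unfold Rdiv; rewrite Rmult_assoc, Rinv_l; lra. }
  assert (HtK : d / K * K = d) by (field; lra).
  assert (Hg : K - d + L <= / f).
  { apply (Rmult_le_reg_r f); [exact Hf |]; rewrite Rinv_l by lra.
    assert (HL : 0 <= K - d + L) by (unfold L; nra).
    apply Rle_trans with ((K - d + L) * (2 * / K - / (K - d))).
    - rewrite (Rmult_comm _ f), (Rmult_comm _ (_ - _)); apply Rmult_le_compat_r; lra.
    - replace ((K - d + L) * (2 * / K - / (K - d)))
        with (1 - 4 * d ^ 3 / (K ^ 2 * (K - d))) by (unfold L; field; lra).
      assert (0 <= 4 * d ^ 3 / (K ^ 2 * (K - d))).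
      { apply Rdiv_le_0_compat; [| apply Rmult_lt_0_compat; nra].
        pose proof (pow_le d 3 (proj1 Hd)); lra. }
      lra. }
  assert (Hs : A - L / 4 <= sqrt (u * v + (K - d) * A)).
  { destruct (Rle_lt_dec 0 (A - L / 4)) as [Hp | Hn].
    2:{ pose proof (sqrt_pos (u * v + (K - d) * A)); lra. }
    rewrite <- (sqrt_pow2 (A - L / 4)) by exact Hp; apply sqrt_le_1_alt.
    replace (u * v + (K - d) * A) with (A ^ 2 - A * d).
    2:{ transitivity (u * v + K * A - A * d); [rewrite HKA; unfold A; ring | ring]. }
    unfold L; set (t := d / K) in *; rewrite <- HtK.
    assert (Hkey : K * (1 + t) ^ 2 <= 4 * A) by nra.
    assert (0 <= K * t ^ 2) by nra.
    assert (0 <= (K * t ^ 2) * (4 * A - K * (1 + t) ^ 2)) by (apply Rmult_le_pos; lra).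
    lra. }
  lra.
Qed.

(** The packing in the enclosing disk itself: c fills one pocket between a and b,
    and f lies in the other. *)
Lemma packable_soddy (a b c f : R) :
  0 < c <= b -> b <= a -> 0 < f -> pocket a b < c -> c + f <= 2 * pocket a b ->
  0 < enclosing_curv a b c ->
  packable (/ enclosing_curv a b c) (a :: b :: c :: f :: nil).
Proof.
  intros Hcb Hba Hf Hp Hcf HT.
  assert (Hva : 0 < / a) by (apply Rinv_0_lt_compat; lra).
  assert (Hvb : 0 < / b) by (apply Rinv_0_lt_compat; lra).
  assert (Hvc : 0 < / c) by (apply Rinv_0_lt_compat; lra).
  pose proof (second_pocket_curvature (/ a) (/ b) (/ c) f Hva Hvb) as Hg.
  assert (HpK : (/ a ^ 2 + / a * / b + / b ^ 2) / (/ a + / b) = / pocket a b).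
  { unfold pocket; field; repeat split; nra. }
  assert (HpK' : (/ a + / b) / (/ a ^ 2 + / a * / b + / b ^ 2) = pocket a b).
  { unfold pocket; field; repeat split; nra. }
  pose proof (pocket_pos a b ltac:(lra) ltac:(lra)) as Hpp.
  rewrite !pow_inv, HpK, HpK', Rinv_inv in Hg.
  specialize (Hg ltac:(split; [| apply Rinv_le_contravar]; lra) Hf Hcf).
  set (T := enclosing_curv a b c) in *.
  set (s := sqrt (/ a * / b + / c * (/ a + / b))) in *.
  assert (Hs0 : 0 <= s) by apply sqrt_pos.
  assert (Hs : s ^ 2 = / a * / b + / c * (/ a + / b)) by (apply pow2_sqrt; nra).
  assert (HTs : T = 2 * s - (/ a + / b + / c)) by reflexivity.
  assert (Hsum : forall x y z, 0 < x -> 0 < y -> 0 < z ->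
            s ^ 2 = x * y + z * (x + y) -> 2 * s < 2 * x + y + z).
  { intros x y z Hx Hy Hz Hsx; apply Rnot_le_lt; intros Hle.
    assert ((2 * x + y + z) ^ 2 <= (2 * s) ^ 2) by (apply pow_incr; lra).
    pose proof (pow2_ge_0 (y - z)); nra. }
  pose proof (Hsum (/ a) (/ b) (/ c) Hva Hvb Hvc Hs) as HTa.
  pose proof (Hsum (/ b) (/ a) (/ c) Hvb Hva Hvc ltac:(rewrite Hs; ring)) as HTb.
  pose proof (Hsum (/ c) (/ a) (/ b) Hvc Hva Hvb ltac:(rewrite Hs; ring)) as HTc.
  assert (Hlt : forall r, T < / r -> 0 < r -> 0 < r < / T).
  { intros r H Hr; split; [exact Hr |].
    rewrite <- (Rinv_inv r); apply Rinv_lt_contravar; [| exact H].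
    apply Rmult_lt_0_compat; lra. }
  assert (Hfc : / c < / f) by (apply Rinv_lt_contravar; nra).
  (* With this q the disk c exactly fills its pocket. *)
  apply packable_pockets with (q := ((/ a + / b - / c) / T - 1) / 2);
    try (apply Hlt; lra); unfold excess, Rdiv; rewrite ?(Rmult_comm (/ T)).
  - apply (Rmult_eq_reg_r (4 * T ^ 2)); [| nra].
    transitivity (4 * (/ a - T) * (/ b - T)); [field; lra |].
    transitivity (4 * T ^ 2 + (/ a + / b - / c - T) ^ 2); [| field; lra].
    rewrite HTs; nra.
  - lra.
  - assert (0 < / T) by (apply Rinv_0_lt_compat; lra).
    assert (HTT : T * / T = 1) by (apply Rinv_r; lra).
    nra.
Qed.

(** * Golden tails *)

Lemma phi_sq : phi ^ 2 = phi + 1.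
Proof.
  unfold phi; pose proof (sqrt_sqrt 5 ltac:(lra)); nra.
Qed.

Lemma phi_bounds : 1.618 < phi < 1.6181.
Proof.
  pose proof phi_sq; assert (0 < phi).
  { unfold phi; pose proof (sqrt_pos 5); lra. }
  split; nra.
Qed.

(** If phi b >= a, then c + f <= phi a - b <= a and a <= 2 pocket; otherwise
    c + f <= phi b <= 2 pocket.  Each last inequality is a quadratic one in b/a with
    root 1/phi. *)
Lemma golden_tail_le_pockets (a b c f : R) :
  0 < b < a ->
  b + c + f <= phi * a -> c + f <= phi * b -> c + f <= 2 * pocket a b.
Proof.
  intros Hab H1 H2; pose proof phi_sq; pose proof phi_bounds.
  unfold pocket.
  assert (0 < a ^ 2 + a * b + b ^ 2) by nra.
  apply (Rmult_le_reg_r (a ^ 2 + a * b + b ^ 2)); [assumption |].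
  replace (2 * (a * b * (a + b) / (a ^ 2 + a * b + b ^ 2)) * (a ^ 2 + a * b + b ^ 2))
    with (2 * (a * b * (a + b))) by (field; lra).
  destruct (Rle_lt_dec a (phi * b)) as [Hb | Hb].
  - assert (Hba : (phi - 1) * a <= b).
    { assert (0 <= (phi - 1) * (phi * b - a)) by (apply Rmult_le_pos; lra). nra. }
    assert (c + f <= a) by lra.
    assert (a ^ 2 <= b ^ 2 + a * b).
    { assert (0 <= (b - (phi - 1) * a) * (b + phi * a)) by (apply Rmult_le_pos; nra). nra. }
    apply Rle_trans with (a * (a ^ 2 + a * b + b ^ 2)); [nra |]. nra.
  - apply Rle_trans with (phi * b * (a ^ 2 + a * b + b ^ 2)); [nra |].
    assert (phi * (a ^ 2 + a * b + b ^ 2) <= 2 * a * (a + b)).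
    { assert (0 <= (a - phi * b) * ((2 - phi) * a + b)) by (apply Rmult_le_pos; nra). nra. }
    nra.
Qed.

(** The conclusion says that a disk of radius m fits at distance two strip widths
    in [packable_pocket_pair].  The tail conditions give f <= b and
    f <= a - b/phi; the first is the better bound if phi b < a, the second if
    phi b >= a. *)
Lemma golden_half_tail_small (a b c f m : R) :
  0 < b < a -> 2 * m <= f ->
  b + c + f <= phi * a -> c + f <= phi * b -> f <= phi * c ->
  m * (1 + a / b + 4 * (b / a)) <= a + b.
Proof.
  intros Hab Hm H1 H2 H3; pose proof phi_sq; pose proof phi_bounds.
  apply (Rmult_le_reg_r (a * b)); [nra |].
  replace (m * (1 + a / b + 4 * (b / a)) * (a * b))
    with (m * (a * b + a ^ 2 + 4 * b ^ 2)) by (field; lra).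
  assert (f <= b) by nra.
  assert (phi * f <= phi * a - b) by nra.
  destruct (Rle_lt_dec a (phi * b)) as [Hb | Hb].
  - assert (Hba : (phi - 1) * a <= b).
    { assert (0 <= (phi - 1) * (phi * b - a)) by (apply Rmult_le_pos; lra). nra. }
    assert (f <= (phi - 1) * a).
    { assert (0 <= (phi - 1) * (phi * a - b - phi * f)) by (apply Rmult_le_pos; lra). nra. }
    assert (a * b + a ^ 2 + 4 * b ^ 2 <= 2 * phi * b * (a + b)).
    { assert (0 <= (b - (phi - 1) * a) * (a - b)) by (apply Rmult_le_pos; lra). nra. }
    assert (0 < a * b + a ^ 2 + 4 * b ^ 2) by nra.
    apply Rle_trans with ((phi - 1) * a / 2 * (a * b + a ^ 2 + 4 * b ^ 2)); [nra |].
    apply Rle_trans with ((phi - 1) * a / 2 * (2 * phi * b * (a + b))).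
    + apply Rmult_le_compat_l; nra.
    + right; replace ((phi - 1) * a / 2 * (2 * phi * b * (a + b))) with ((phi ^ 2 - phi) * (a * b * (a + b))) by field.
      replace (phi ^ 2 - phi) with 1 by lra; ring.
  - assert (0 < a * b + a ^ 2 + 4 * b ^ 2) by nra.
    apply Rle_trans with (b / 2 * (a * b + a ^ 2 + 4 * b ^ 2)); [nra |].
    assert (a * b + a ^ 2 + 4 * b ^ 2 <= 2 * a * (a + b)) by nra.
    nra.
Qed.

(** The first radius d of the tail is kept apart from the others because it may
    have to go into a different pocket than they do. *)
Lemma fits_golden_tail (a b c d rho : R) (l : list R) :
  b < a -> c <= b -> 0 < d <= c -> Forall (fun x => 0 < x) l ->
  b + c + d + lsum l <= phi * a -> c + d + lsum l <= phi * b ->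
  d + lsum l <= phi * c -> lsum l <= phi * d ->
  fits (a :: b :: c :: nil) rho -> fits (a :: b :: c :: d :: l) rho.
Proof.
  intros Hab Hbc Hcd Hl Ta Tb Tc Td Hf; apply packable_fits.
  assert (Hs : 0 <= lsum l).
  { clear - Hl; unfold lsum; induction Hl; simpl; lra. }
  set (e := lsum l) in *.
  assert (Hdl : Forall (fun x => 0 < x) (d :: l)) by (constructor; [lra | exact Hl]).
  assert (Hdle : lsum (d :: l) <= d + e) by (apply Rle_refl).
  pose proof (golden_tail_le_pockets a b c (d + e) ltac:(lra) ltac:(lra) ltac:(lra)) as Hcf.
  destruct (Rle_lt_dec c (pocket a b)) as [Hcp | Hcp].
  - pose proof (fits_two_le a b c rho ltac:(lra) ltac:(lra) ltac:(lra) Hf) as Hrho.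
    apply (packable_le _ _ _ Hrho).
    destruct (Rle_lt_dec (d + e) (pocket a b)) as [Hfp | Hfp].
    + apply (packable_split_disk _ _ (d :: l) (a :: b :: c :: nil) nil Hdl Hdle).
      apply packable_two_pockets; lra.
    + pose proof phi_sq; pose proof phi_bounds.
      (* Adding e <= phi d and (d + e) phi <= phi^2 c bounds (1 + phi) e by phi^2 c. *)
      assert (Hec : e <= c) by nra.
      destruct (Rle_lt_dec e d) as [Hed | Hed].
      * apply (packable_split_disk _ e l (a :: b :: c :: d :: nil) nil Hl (Rle_refl _)).
        apply packable_pocket_pair; try lra.
        apply (golden_half_tail_small a b c (d + e)); lra.
      * apply (packable_split_disk _ e l (a :: b :: c :: nil) (d :: nil) Hl (Rle_refl _)).
        apply packable_pocket_pair; try lra.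
        apply (golden_half_tail_small a b c (d + e)); lra.
  - destruct (fits_three_curvature a b c rho) as [Hrho Hcurv]; try lra; try assumption.
    assert (HT : 0 < enclosing_curv a b c) by nra.
    apply (packable_le (/ enclosing_curv a b c)).
    { apply (Rmult_le_reg_r (enclosing_curv a b c)); [exact HT |]; rewrite Rinv_l; lra. }
    apply (packable_split_disk _ _ (d :: l) (a :: b :: c :: nil) nil Hdl Hdle).
    apply packable_soddy; lra.
Qed.

Lemma sum_n_m_lsum (r : nat -> R) (k i : nat) :
  sum_n_m r (S i) (i + k) = lsum (map r (seq (S i) k)).
Proof.
  revert i; induction k as [| k IH]; intros i.
  - rewrite sum_n_m_zero by lia; reflexivity.
  - rewrite sum_Sn_m by lia.
    replace (i + S k)%nat with (S i + k)%nat by lia; rewrite IH; reflexivity.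
Qed.

Theorem theorem28 (n : nat) (r : nat -> R)
    (hn : (3 <= n)%nat)
    (hab : r 1%nat > r 2%nat)
    (hdecr : forall i : nat, (2 <= i < n)%nat -> r i >= r (S i))
    (hpos : r n > 0)
    (htail : forall i : nat, (1 <= i <= n)%nat ->
       sum_n_m r (S i) n <= phi * r i) :
  forall rho : R, rho > 0 ->
    (fits (map r (seq 1 n)) rho <->
     fits (r 1%nat :: r 2%nat :: r 3%nat :: nil) rho).
Proof.
  intros rho _; destruct n as [| [| [| k]]]; try lia.
  change (map r (seq 1 (S (S (S k)))))
    with ((r 1%nat :: r 2%nat :: r 3%nat :: nil) ++ map r (seq 4 k)).
  split; [apply fits_app_l |].
  destruct k as [| k]; [exact (fun H => H) | intros Hf].
  assert (Hpos : forall i, (i <= S (S k))%nat -> 0 < r (S (S (S (S k))) - i)%nat).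
  { induction i as [| i IH]; intros Hi; [apply hpos |].
    specialize (IH ltac:(lia)).
    pose proof (hdecr (S (S (S (S k))) - S i)%nat ltac:(lia)) as H.
    replace (S (S (S (S (S k))) - S i))%nat with (S (S (S (S k))) - i)%nat in H by lia.
    lra. }
  assert (Htail : forall i m, (1 <= i)%nat -> (i + m = S (S (S (S k))))%nat ->
            lsum (map r (seq (S i) m)) <= phi * r i).
  { intros i m Hi Him; rewrite <- sum_n_m_lsum, Him; apply htail; lia. }
  pose proof (Htail 1%nat (S (S (S k))) ltac:(lia) ltac:(lia)) as T1.
  pose proof (Htail 2%nat (S (S k)) ltac:(lia) ltac:(lia)) as T2.
  pose proof (Htail 3%nat (S k) ltac:(lia) ltac:(lia)) as T3.
  pose proof (Htail 4%nat k ltac:(lia) ltac:(lia)) as T4.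
  pose proof (hdecr 2%nat ltac:(lia)); pose proof (hdecr 3%nat ltac:(lia)).
  pose proof (Hpos k ltac:(lia)) as H4.
  replace (S (S (S (S k))) - k)%nat with 4%nat in H4 by lia.
  change (r 2%nat + (r 3%nat + (r 4%nat + lsum (map r (seq 5 k)))) <= phi * r 1%nat) in T1.
  change (r 3%nat + (r 4%nat + lsum (map r (seq 5 k))) <= phi * r 2%nat) in T2.
  change (r 4%nat + lsum (map r (seq 5 k)) <= phi * r 3%nat) in T3.
  apply (fits_golden_tail _ _ _ _ rho (map r (seq 5 k))); try lra; try assumption.
  apply Forall_map, Forall_forall; intros i Hi; apply in_seq in Hi.
  replace i with (S (S (S (S k))) - (S (S (S (S k))) - i))%nat by lia.
  apply Hpos; lia.
Qed.
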